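(* Let $\widetilde\gamma$ be a non-helical and non-planar Bertrand mate curve of a (non-helical and non-planar) Bertrand curve $\gamma$ in Euclidean 3-space, and let $\widetilde\gamma_n=\widetilde N$ be its principal normal indicatrix, so that $\widetilde\gamma_n=\epsilon N$. Let $f=\tau/\kappa$, $g=\tau'/\kappa'$, where $'$ on $\kappa,\tau$ denotes $d/ds$, and $$\sigma=\sqrt{\kappa'^{2}(g-f)^{2}+\kappa^{4}(1+f^{2})^{3}}.$$ Then the Frenet frame $\{\widetilde T_n,\widetilde N_n,\widetilde B_n\}$ of $\widetilde\gamma_n$, with respect to its natural (arclength) parameter $s_n^{*}$, is $$\widetilde T_n=\frac{-\epsilon}{\sqrt{1+f^{2}}}\{T-fB\},$$ $$\widetilde N_n=\frac{\epsilon}{\sigma\sqrt{1+f^{2}}}\left\{f\kappa'(g-f)T-\kappa^{2}(1+f^{2})^{2}N+\kappa'(g-f)B\right\},$$ $$\widetilde B_n=\frac1\sigma\left\{f\kappa^{2}(1+f^{2})T+\kappa'(g-f)N+\kappa^{2}(1+f^{2})B\right\},$$ and it satisfies $\widetilde T_n'=\widetilde\kappa_n\widetilde N_n$, $\widetilde N_n'=-\widetilde\kappa_n\widetilde T_n+\widetilde\tau_n\widetilde B_n$, $\widetilde B_n'=-\widetilde\tau_n\widetilde N_n$ (derivatives with respect to $s_n^{*}$), where $$s_n^{*}=\int\frac{\kappa(g-f)\sqrt{1+f^{2}}}{f\sqrt{1+g^{2}}}\,ds^{*},\qquad \widetilde\kappa_n=\frac{\sigma}{\kappa^{2}(1+f^{2})^{3/2}},$$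 $$\widetilde\tau_n=\frac{-\epsilon(g-f)}{\sigma^{2}}\left\{3f\kappa'^{2}(g-f)+(3\kappa'^{2}-\kappa\kappa'')(1+f^{2})\right\}$$ are the arclength parameter, curvature and torsion of $\widetilde\gamma_n$.
   Context: Curves are smooth regular curves in $\mathbb{R}^3$ with positive curvature; $\gamma$ is parameterized by arclength $s$ with Frenet frame $T,N,B$, curvature $\kappa$, torsion $\tau$, and its mate $\widetilde\gamma$ by arclength $s^{*}$ with Frenet frame $\widetilde T,\widetilde N,\widetilde B$. $\widetilde\gamma$ is the Bertrand mate of the Bertrand curve $\gamma$ if there is a correspondence of points such that $N=\epsilon\widetilde N$ with $\epsilon=\pm1$ and $\widetilde\gamma(s^{*})=\gamma(s)+\lambda N(s)$ with $\lambda\neq0$ constant; here $\lambda=\frac{g}{\kappa(g-f)}$. The paper's convention relating the arclength parameters is $\frac{ds^{*}}{ds}=\frac{f\sqrt{1+g^{2}}}{g-f}$. Non-helical means that torsion/curvature is not constant, non-planar that the torsion is non-zero; it is assumed that $\kappa'\neq0$, $f\neq0$, $g\neq f$ at each point. The principal normal indicatrix of $\widetilde\gamma$ is the curve $\widetilde N(s^{*})$ on the unit sphere. *)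

(* Defs.v *)
From Stdlib Require Import Reals.
From Coquelicot Require Import Coquelicot.
Open Scope R_scope.

(* R^3 is the triple (x, y, z) = ((x, y), z), with Coquelicot's product
   normed-module structure: plus, minus, scal and is_derive below are
   Coquelicot's.  The norm of that structure is not used; lengths are measured
   by [vnorm]. *)
Definition vec : NormedModule R_AbsRing :=
  prod_NormedModule R_AbsRing
    (prod_NormedModule R_AbsRing R_NormedModule R_NormedModule) R_NormedModule.

Definition vx (v : vec) : R := fst (fst v).
Definition vy (v : vec) : R := snd (fst v).
Definition vz (v : vec) : R := snd v.

Declare Scope vec_scope.
Delimit Scope vec_scope with vec.
Notation "u + v" := (@plus (NormedModule.AbelianGroup R_AbsRing vec) u v) : vec_scope.
Notation "u - v" := (@minus (NormedModule.AbelianGroup R_AbsRing vec) u v) : vec_scope.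
Notation "a *: v" := (@scal R_AbsRing (NormedModule.ModuleSpace R_AbsRing vec) a%R v)
  (at level 40, left associativity) : vec_scope.

Definition dot (u v : vec) : R := vx u * vx v + vy u * vy v + vz u * vz v.

Definition vnorm (v : vec) : R := sqrt (dot v v).

Definition cross (u v : vec) : vec :=
  (vy u * vz v - vz u * vy v,
   vz u * vx v - vx u * vz v,
   vx u * vy v - vy u * vx v).

Definition vderive (c : R -> vec) (s : R) : vec :=
  (Derive (fun t => vx (c t)) s,
   Derive (fun t => vy (c t)) s,
   Derive (fun t => vz (c t)) s).

Definition vsmooth_on (I : R -> Prop) (c : R -> vec) : Prop :=
  forall (n : nat) (s : R), I s ->
    ex_derive_n (fun t => vx (c t)) n s /\
    ex_derive_n (fun t => vy (c t)) n s /\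
    ex_derive_n (fun t => vz (c t)) n s.

Definition open_interval (I : R -> Prop) : Prop :=
  (exists x, I x) /\ open I /\
  (forall x y z, I x -> I z -> x <= y <= z -> I y).

(* These are the Frenet frame, curvature and torsion only for a curve
   parameterized by arclength with positive curvature, see [frenet_curve].
   The sign of the torsion is fixed by B' = - tau N. *)
Definition tangent (c : R -> vec) (s : R) : vec := vderive c s.

Definition curvature (c : R -> vec) (s : R) : R := vnorm (vderive (tangent c) s).

Definition normal (c : R -> vec) (s : R) : vec :=
  (/ curvature c s *: vderive (tangent c) s)%vec.

Definition binormal (c : R -> vec) (s : R) : vec :=
  cross (tangent c s) (normal c s).

Definition torsion (c : R -> vec) (s : R) : R :=
  - dot (vderive (binormal c) s) (normal c s).

Definition frenet_curve (I : R -> Prop) (c : R -> vec) : Prop :=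
  open_interval I /\ vsmooth_on I c /\
  (forall s, I s -> vnorm (vderive c s) = 1) /\
  (forall s, I s -> 0 < curvature c s).

Definition non_helical (I : R -> Prop) (c : R -> vec) : Prop :=
  ~ exists k : R, forall s, I s -> torsion c s / curvature c s = k.

Definition non_planar (I : R -> Prop) (c : R -> vec) : Prop :=
  forall s, I s -> torsion c s <> 0.

Definition correspondence (I J : R -> Prop) (phi psi : R -> R) : Prop :=
  (forall s, I s -> J (phi s) /\ psi (phi s) = s) /\
  (forall u, J u -> I (psi u) /\ phi (psi u) = u).

(* phi takes the arclength parameter of c to that of d, psi is its inverse; the
   sign eps is the same at all points. *)
Definition bertrand_mate (I : R -> Prop) (c : R -> vec)
    (J : R -> Prop) (d : R -> vec) (phi psi : R -> R) (eps : R) : Prop :=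
  frenet_curve I c /\ frenet_curve J d /\
  correspondence I J phi psi /\
  (eps = 1 \/ eps = -1) /\
  (forall s, I s -> normal c s = (eps *: normal d (phi s))%vec) /\
  exists lambda : R, lambda <> 0 /\
    forall s, I s -> d (phi s) = (c s + lambda *: normal c s)%vec.

(* Main.v *)
Require Import Defs.
From Stdlib Require Import Reals Lra ClassicalEpsilon.
From Stdlib Require Ranalysis5.
From Coquelicot Require Import Coquelicot.
Open Scope R_scope.

(** The tangent of the mate makes constant angles with T and B, so that
    differentiating the mate's equation gives a tau + b kappa = const with constants
    a, b; hence g = tau'/kappa' is constant.  The map s |-> s_n has derivative
    kappa sqrt(1+f^2) > 0, so it has a smooth inverse p, and the indicatrix is
    eps (N o p).  Since f' = kappa'(g-f)/kappa with g constant, everything is then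
    computed in coordinates with respect to the frame (T, N, B) of gamma. *)

(** * Smooth functions on an open set *)

(** Once g is known to be constant, the mate contributes only its normal, which is N up to the sign
    eps, and its parameter s*. Constancy of g is what makes the torsion formula come out:
    differentiating kappa'(g-f) produces no g', so tau'' never appears. The obstacle is that no
    explicit inverse is at hand for s* or s_n: the inverse of s* is given merely pointwise, without
    continuity, and that of s_n has to be constructed. Hence the part on monotone functions; it has
    to admit decreasing ones, because f/(g-f), and with it ds*/ds, may be negative. *)

(* [n]-fold differentiability: [C_on 0] is trivial, continuity is not included. *)
Fixpoint C_on (n : nat) (I : R -> Prop) (f : R -> R) : Prop :=
  match n with
  | O => True
  | S n => exists f', (forall s, I s -> is_derive f s (f' s)) /\ C_on n I f'
  end.

Definition smooth_on (I : R -> Prop) (f : R -> R) : Prop := forall n, C_on n I f.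

Lemma is_derive_eq (f : R -> R) (s l l' : R) :
  is_derive f s l -> l = l' -> is_derive f s l'.
Proof. intros H <-; exact H. Qed.

Lemma is_derive_ext_open (I : R -> Prop) (f g : R -> R) (s l : R) :
  open I -> I s -> (forall t, I t -> f t = g t) ->
  is_derive f s l -> is_derive g s l.
Proof.
intros oI Is e; apply is_derive_ext_loc.
exact (filter_imp I _ e (oI s Is)).
Qed.

(** In the product, inverse and square root rules the derivative contains the original function
    again, so those inductions need it at the lower order as well. *)
Lemma C_on_S (n : nat) (I : R -> Prop) (f : R -> R) : C_on (S n) I f -> C_on n I f.
Proof.
revert f; induction n as [|n IH]; intros f; [easy|].
intros [f' [d H]]; exists f'; split; [exact d | exact (IH f' H)].
Qed.

Lemma C_on_ext (n : nat) (I : R -> Prop) (f g : R -> R) :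
  open I -> (forall s, I s -> f s = g s) -> C_on n I f -> C_on n I g.
Proof.
intros oI e; destruct n as [|n]; [easy|].
intros [f' [d H]]; exists f'; split; [|exact H].
intros s Is; apply (is_derive_ext_open I f); auto.
Qed.

Lemma C_on_ex_derive_n (n : nat) (I : R -> Prop) (f : R -> R) :
  open I -> C_on n I f -> forall s, I s -> ex_derive_n f n s.
Proof.
intros oI; revert f; induction n as [|n IH]; intros f; [easy|].
intros [f' [d H]] s Is.
destruct n as [|n]; [exists (f' s); exact (d s Is)|].
assert (E := IH f' H s Is); cbn in E |- *.
revert E; apply ex_derive_ext_loc.
(* [f'] agrees with [Derive f] only on [I], so their higher derivatives are compared through germs
   at points of the open set [I]. *)
assert (L : forall t, I t -> locally t (fun r => f' r = Derive f r)).
{ intros t It; apply (filter_imp I); [|exact (oI t It)].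
  intros r Ir; symmetry; apply is_derive_unique; auto. }
apply (filter_imp I); [|exact (oI s Is)].
intros t It; rewrite (Derive_n_ext_loc _ _ n t (L t It)).
rewrite (Derive_n_comp f n 1); replace (n + 1)%nat with (S n) by ring.
reflexivity.
Qed.

Lemma smooth_on_ex_derive_n (I : R -> Prop) (f : R -> R) :
  (forall n s, I s -> ex_derive_n f n s) -> smooth_on I f.
Proof.
intros H n.
(* All iterated derivatives are treated at once, since the derivative of [Derive_n f m] is
   [Derive_n f (S m)]. *)
cut (forall m, C_on n I (Derive_n f m)); [intros C; exact (C 0%nat)|].
induction n as [|n IH]; intros m; [easy|].
exists (Derive_n f (S m)); split; [|apply IH].
intros s Is; exact (Derive_correct _ _ (H (S m) s Is)).
Qed.

Lemma smooth_on_ext (I : R -> Prop) (f g : R -> R) :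
  open I -> (forall s, I s -> f s = g s) -> smooth_on I f -> smooth_on I g.
Proof. intros oI e H n; exact (C_on_ext n I f g oI e (H n)). Qed.

Lemma smooth_on_is_derive (I : R -> Prop) (f : R -> R) (s : R) :
  smooth_on I f -> I s -> is_derive f s (Derive f s).
Proof.
intros H Is; destruct (H 1%nat) as [f' [d _]].
apply Derive_correct; exists (f' s); exact (d s Is).
Qed.

Lemma smooth_on_Derive (I : R -> Prop) (f : R -> R) :
  open I -> smooth_on I f -> smooth_on I (Derive f).
Proof.
intros oI H n; destruct (H (S n)) as [f' [d C]].
apply (C_on_ext n I f'); auto.
intros s Is; symmetry; apply is_derive_unique; auto.
Qed.

Lemma smooth_on_continuous (I : R -> Prop) (f : R -> R) (s : R) :
  smooth_on I f -> I s -> continuous f s.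
Proof.
intros H Is; apply (ex_derive_continuous (V := R_NormedModule)).
exists (Derive f s); exact (smooth_on_is_derive I f s H Is).
Qed.

Lemma C_on_const (n : nat) (I : R -> Prop) (c : R) : C_on n I (fun _ => c).
Proof.
revert c; induction n as [|n IH]; intros c; [easy|].
exists (fun _ => 0); split; [|apply IH].
intros s _; apply (is_derive_const (V := R_NormedModule) c s).
Qed.

Lemma C_on_plus (n : nat) (I : R -> Prop) (f g : R -> R) :
  C_on n I f -> C_on n I g -> C_on n I (fun s => f s + g s).
Proof.
revert f g; induction n as [|n IH]; intros f g; [easy|].
intros [f' [df Cf]] [g' [dg Cg]].
exists (fun s => f' s + g' s); split; [|auto].
intros s Is; apply (is_derive_plus (V := R_NormedModule) f g); auto.
Qed.

Lemma is_derive_Rmult (f g : R -> R) (s a b : R) :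
  is_derive f s a -> is_derive g s b ->
  is_derive (fun t => f t * g t) s (a * g s + f s * b).
Proof. intros df dg; exact (is_derive_mult f g s a b df dg Rmult_comm). Qed.

Lemma C_on_mult (n : nat) (I : R -> Prop) (f g : R -> R) :
  C_on n I f -> C_on n I g -> C_on n I (fun s => f s * g s).
Proof.
revert f g; induction n as [|n IH]; intros f g; [easy|].
intros Sf Sg; assert (Cf0 := C_on_S _ _ _ Sf); assert (Cg0 := C_on_S _ _ _ Sg).
destruct Sf as [f' [df Cf]]; destruct Sg as [g' [dg Cg]].
exists (fun s => f' s * g s + f s * g' s); split.
- intros s Is; apply is_derive_Rmult; auto.
- apply C_on_plus; auto.
Qed.

Lemma C_on_pow (n m : nat) (I : R -> Prop) (f : R -> R) :
  C_on n I f -> C_on n I (fun s => f s ^ m).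
Proof.
intros Cf; induction m as [|m IH]; [exact (C_on_const n I 1)|].
apply C_on_mult; assumption.
Qed.

Lemma C_on_opp (n : nat) (I : R -> Prop) (f : R -> R) :
  C_on n I f -> C_on n I (fun s => - f s).
Proof.
revert f; induction n as [|n IH]; intros f; [easy|].
intros [f' [d C]]; exists (fun s => - f' s); split; [|auto].
intros s Is; apply (is_derive_opp (V := R_NormedModule) f); auto.
Qed.

Lemma C_on_inv (n : nat) (I : R -> Prop) (f : R -> R) :
  (forall s, I s -> f s <> 0) -> C_on n I f -> C_on n I (fun s => / f s).
Proof.
intros nz; revert f nz; induction n as [|n IH]; intros f nz; [easy|].
intros S; assert (C0 := IH f nz (C_on_S _ _ _ S)); destruct S as [f' [d C]].
exists (fun s => - f' s * (/ f s * / f s)); split.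
- intros s Is; apply (is_derive_eq _ _ _ _ (is_derive_inv f s _ (d s Is) (nz s Is))).
  field; exact (nz s Is).
- apply C_on_mult; [apply C_on_opp | apply C_on_mult]; auto.
Qed.

Lemma C_on_sqrt (n : nat) (I : R -> Prop) (f : R -> R) :
  (forall s, I s -> 0 < f s) -> C_on n I f -> C_on n I (fun s => sqrt (f s)).
Proof.
intros pos; revert f pos; induction n as [|n IH]; intros f pos; [easy|].
intros S; assert (C0 := IH f pos (C_on_S _ _ _ S)); destruct S as [f' [d C]].
exists (fun s => f' s * / (2 * sqrt (f s))); split.
- intros s Is; exact (is_derive_sqrt f s _ (d s Is) (pos s Is)).
- apply C_on_mult; [exact C|].
  apply C_on_inv; [|apply C_on_mult; [apply C_on_const | exact C0]].
  intros s Is; assert (P := sqrt_lt_R0 _ (pos s Is)); lra.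
Qed.

Lemma is_derive_Rcomp (f p : R -> R) (t a b : R) :
  is_derive f (p t) a -> is_derive p t b -> is_derive (fun r => f (p r)) t (b * a).
Proof. intros df dp; exact (is_derive_comp f p t a b df dp). Qed.

(* Every derivative of [G o p] is again of the form [(smooth on I) o p], because
   [p] solves the autonomous equation [p' = h o p]. *)
Lemma C_on_flow (n : nat) (I K : R -> Prop) (p h G : R -> R) :
  (forall t, K t -> I (p t)) -> (forall t, K t -> is_derive p t (h (p t))) ->
  C_on n I h -> C_on n I G -> C_on n K (fun t => G (p t)).
Proof.
intros KI dp; revert G; induction n as [|n IH]; intros G; [easy|].
intros Ch [G' [dG CG]]; assert (Ch0 := C_on_S _ _ _ Ch).
exists (fun t => h (p t) * G' (p t)); split.
- intros t Kt; apply is_derive_Rcomp; auto.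
- apply (IH (fun s => h s * G' s)); [|apply C_on_mult]; assumption.
Qed.

(** * Vector calculus *)

(** Calculus is done coordinatewise; the derivative in the normed module [vec] is recovered only for
    the final Frenet equations. *)
Definition is_vderive (c : R -> vec) (s : R) (v : vec) : Prop :=
  is_derive (fun t => vx (c t)) s (vx v) /\
  is_derive (fun t => vy (c t)) s (vy v) /\
  is_derive (fun t => vz (c t)) s (vz v).

Definition vsmooth (I : R -> Prop) (c : R -> vec) : Prop :=
  smooth_on I (fun t => vx (c t)) /\ smooth_on I (fun t => vy (c t)) /\
  smooth_on I (fun t => vz (c t)).

Lemma vec_eq (u v : vec) : vx u = vx v -> vy u = vy v -> vz u = vz v -> u = v.
Proof. destruct u as [[a b] c], v as [[a' b'] c']; cbn; intros -> -> ->; reflexivity. Qed.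

Lemma is_derive_pair (U V : NormedModule R_AbsRing) (f : R -> U) (g : R -> V)
    (s : R) (a : U) (b : V) :
  is_derive f s a -> is_derive g s b ->
  is_derive (fun t => ((f t, g t) : prod_NormedModule R_AbsRing U V)) s (a, b).
Proof.
intros df dg; unfold is_derive.
apply (filterdiff_ext_lin (K := R_AbsRing)) with
  (l1 := fun y : R => ((scal y a, scal y b) : prod_NormedModule R_AbsRing U V));
  [|reflexivity].
apply (filterdiff_comp'_2 f g (fun u v => ((u, v) : prod_NormedModule R_AbsRing U V)) s
  _ _ (fun u v => ((u, v) : prod_NormedModule R_AbsRing U V)) df dg).
apply filterdiff_linear.
apply (is_linear_prod (fun t : prod_NormedModule R_AbsRing U V => fst t)
  (fun t => snd t)); [apply is_linear_fst | apply is_linear_snd].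
Qed.

Lemma is_vderive_is_derive (c : R -> vec) (s : R) (v : vec) :
  is_vderive c s v -> is_derive c s v.
Proof.
intros [dx [dy dz]].
assert (D := is_derive_pair _ _ _ _ _ _ _ (is_derive_pair _ _ _ _ _ _ _ dx dy) dz).
destruct v as [[a b] c0].
refine (is_derive_ext _ _ _ _ _ D).
intros t; destruct (c t) as [[x y] z]; reflexivity.
Qed.

Lemma is_vderive_vderive (c : R -> vec) (s : R) (v : vec) :
  is_vderive c s v -> vderive c s = v.
Proof.
intros [dx [dy dz]].
apply vec_eq; apply is_derive_unique; assumption.
Qed.

Lemma is_vderive_ext_open (I : R -> Prop) (c d : R -> vec) (s : R) (v : vec) :
  open I -> I s -> (forall t, I t -> c t = d t) ->
  is_vderive c s v -> is_vderive d s v.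
Proof.
intros oI Is e [dx [dy dz]].
split; [|split];
  [revert dx | revert dy | revert dz];
  apply (is_derive_ext_open I); auto; intros t It; rewrite (e t It); reflexivity.
Qed.

Lemma vsmooth_vderive (I : R -> Prop) (c : R -> vec) :
  open I -> vsmooth I c -> vsmooth I (vderive c).
Proof.
intros oI [Sx [Sy Sz]]; split; [|split]; unfold vderive; cbn;
  apply smooth_on_Derive; auto.
Qed.

Lemma vsmooth_is_vderive (I : R -> Prop) (c : R -> vec) (s : R) :
  vsmooth I c -> I s -> is_vderive c s (vderive c s).
Proof.
intros [Sx [Sy Sz]] Is; split; [|split];
  apply (smooth_on_is_derive I); assumption.
Qed.

Lemma vsmooth_on_vsmooth (I : R -> Prop) (c : R -> vec) :
  vsmooth_on I c -> vsmooth I c.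
Proof.
intros H; split; [|split]; apply smooth_on_ex_derive_n; intros n s Is;
  destruct (H n s Is) as [hx [hy hz]]; assumption.
Qed.

Lemma vsmooth_vsmooth_on (I : R -> Prop) (c : R -> vec) :
  open I -> vsmooth I c -> vsmooth_on I c.
Proof.
intros oI [Sx [Sy Sz]] n s Is; split; [|split];
  apply (C_on_ex_derive_n n I); auto.
Qed.

Lemma vsmooth_ext (I : R -> Prop) (c d : R -> vec) :
  open I -> (forall s, I s -> c s = d s) -> vsmooth I c -> vsmooth I d.
Proof.
intros oI e [Sx [Sy Sz]].
split; [|split]; [revert Sx | revert Sy | revert Sz];
  apply smooth_on_ext; auto; intros s Is; rewrite (e s Is); reflexivity.
Qed.

Lemma vsmooth_scal (I : R -> Prop) (f : R -> R) (c : R -> vec) :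
  smooth_on I f -> vsmooth I c -> vsmooth I (fun s => (f s *: c s)%vec).
Proof. intros Sf [Sx [Sy Sz]]; split; [|split]; intros n; apply C_on_mult; auto. Qed.

Lemma vsmooth_cross (I : R -> Prop) (c d : R -> vec) :
  vsmooth I c -> vsmooth I d -> vsmooth I (fun s => cross (c s) (d s)).
Proof.
intros [cx [cy cz]] [dx [dy dz]]; split; [|split]; intros n; unfold cross; cbn;
  apply C_on_plus; [|apply C_on_opp| |apply C_on_opp| |apply C_on_opp]; apply C_on_mult; auto.
Qed.

Lemma smooth_dot (I : R -> Prop) (c d : R -> vec) :
  vsmooth I c -> vsmooth I d -> smooth_on I (fun s => dot (c s) (d s)).
Proof.
intros [cx [cy cz]] [dx [dy dz]] n.
apply C_on_plus; [apply C_on_plus|]; apply C_on_mult; auto.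
Qed.

Lemma vsmooth_flow (I K : R -> Prop) (p h : R -> R) (c : R -> vec) :
  (forall t, K t -> I (p t)) -> (forall t, K t -> is_derive p t (h (p t))) ->
  smooth_on I h -> vsmooth I c -> vsmooth K (fun t => c (p t)).
Proof.
intros KI dp Sh [Sx [Sy Sz]]; split; [|split]; intros n;
  [apply (C_on_flow n I K p h (fun s => vx (c s)))
  |apply (C_on_flow n I K p h (fun s => vy (c s)))
  |apply (C_on_flow n I K p h (fun s => vz (c s)))]; auto.
Qed.

Lemma is_vderive_plus (c d : R -> vec) (s : R) (u v : vec) :
  is_vderive c s u -> is_vderive d s v ->
  is_vderive (fun t => (c t + d t)%vec) s (u + v)%vec.
Proof.
intros [cx [cy cz]] [dx [dy dz]]; split; [|split];
  [exact (is_derive_plus _ _ _ _ _ cx dx)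
  |exact (is_derive_plus _ _ _ _ _ cy dy)
  |exact (is_derive_plus _ _ _ _ _ cz dz)].
Qed.

Lemma is_vderive_scal (f : R -> R) (c : R -> vec) (s a : R) (v : vec) :
  is_derive f s a -> is_vderive c s v ->
  is_vderive (fun t => (f t *: c t)%vec) s (a *: c s + f s *: v)%vec.
Proof.
intros df [cx [cy cz]]; split; [|split];
  [exact (is_derive_Rmult _ _ _ _ _ df cx)
  |exact (is_derive_Rmult _ _ _ _ _ df cy)
  |exact (is_derive_Rmult _ _ _ _ _ df cz)].
Qed.

Lemma is_vderive_comp (c : R -> vec) (p : R -> R) (t a : R) (v : vec) :
  is_vderive c (p t) v -> is_derive p t a ->
  is_vderive (fun r => c (p r)) t (a *: v)%vec.
Proof.
intros [cx [cy cz]] dp; split; [|split];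
  [exact (is_derive_Rcomp _ _ _ _ _ cx dp)
  |exact (is_derive_Rcomp _ _ _ _ _ cy dp)
  |exact (is_derive_Rcomp _ _ _ _ _ cz dp)].
Qed.

Lemma is_derive_dot (c d : R -> vec) (s : R) (u v : vec) :
  is_vderive c s u -> is_vderive d s v ->
  is_derive (fun t => dot (c t) (d t)) s (dot u (d s) + dot (c s) v).
Proof.
intros [cx [cy cz]] [dx [dy dz]].
assert (X := is_derive_Rmult _ _ _ _ _ cx dx).
assert (Y := is_derive_Rmult _ _ _ _ _ cy dy).
assert (Z := is_derive_Rmult _ _ _ _ _ cz dz).
apply (is_derive_eq _ _ _ _
  (is_derive_plus _ _ _ _ _ (is_derive_plus _ _ _ _ _ X Y) Z)).
unfold dot, plus; cbn; ring.
Qed.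

Lemma is_vderive_cross (c d : R -> vec) (s : R) (u v : vec) :
  is_vderive c s u -> is_vderive d s v ->
  is_vderive (fun t => cross (c t) (d t)) s (cross u (d s) + cross (c s) v)%vec.
Proof.
intros [cx [cy cz]] [dx [dy dz]].
assert (M := fun f g a b => is_derive_Rmult f g s a b).
split; [|split].
- apply (is_derive_eq _ _ _ _ (is_derive_minus _ _ _ _ _ (M _ _ _ _ cy dz) (M _ _ _ _ cz dy))).
  unfold vx, minus, plus, opp, cross; cbn; unfold plus; cbn; ring.
- apply (is_derive_eq _ _ _ _ (is_derive_minus _ _ _ _ _ (M _ _ _ _ cz dx) (M _ _ _ _ cx dz))).
  unfold vy, minus, plus, opp, cross; cbn; unfold plus; cbn; ring.
- apply (is_derive_eq _ _ _ _ (is_derive_minus _ _ _ _ _ (M _ _ _ _ cx dy) (M _ _ _ _ cy dx))).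
  unfold vz, minus, plus, opp, cross; cbn; unfold plus; cbn; ring.
Qed.

(** * Orthonormal frames *)

Definition frame (T N B : vec) : Prop :=
  dot T T = 1 /\ dot N N = 1 /\ dot T N = 0 /\ B = cross T N.

Definition comb (T N B : vec) (a b c : R) : vec := (a *: T + b *: N + c *: B)%vec.

Ltac vec_ring :=
  try apply vec_eq;
  unfold comb, dot, cross, vx, vy, vz, minus, plus, opp, scal; cbn;
  unfold mult, plus, opp; cbn; ring.

Lemma dot_comm (u v : vec) : dot u v = dot v u.
Proof. vec_ring. Qed.

Lemma dot_scal_l (a : R) (u v : vec) : dot (a *: u)%vec v = a * dot u v.
Proof. vec_ring. Qed.

Lemma scal_scal (a b : R) (v : vec) : (a *: (b *: v))%vec = ((a * b) *: v)%vec.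
Proof. vec_ring. Qed.

Lemma scal_1 (v : vec) : (1 *: v)%vec = v.
Proof. vec_ring. Qed.

Lemma dot_pos (u : vec) : 0 <= dot u u.
Proof. unfold dot; nra. Qed.

Lemma vnorm_sqr (u : vec) : vnorm u * vnorm u = dot u u.
Proof. apply sqrt_sqrt, dot_pos. Qed.

Lemma frame_dots (T N B : vec) :
  frame T N B -> dot B B = 1 /\ dot T B = 0 /\ dot N B = 0.
Proof.
intros [TT [NN [TN ->]]]; split; [|split; vec_ring].
(* Lagrange's identity for the length of a cross product. *)
transitivity (dot T T * dot N N - dot T N * dot T N); [vec_ring|].
rewrite TT, NN, TN; ring.
Qed.

Lemma frame_crosses (T N B : vec) :
  frame T N B -> cross N B = T /\ cross B T = N.
Proof.
intros [TT [NN [TN ->]]]; split.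
(* With B = T x N both products are vector triple products. *)
- transitivity (dot N N *: T - dot T N *: N)%vec; [vec_ring|].
  rewrite NN, TN; vec_ring.
- transitivity (dot T T *: N - dot T N *: T)%vec; [vec_ring|].
  rewrite TT, TN; vec_ring.
Qed.

(** Cramer's rule, a polynomial identity for any three vectors. For a frame the determinant is
    [dot B B = 1] and the cross products are T, N, B again, which gives the expansion below without
    any dimension argument. *)
Lemma vec_cramer (T N B v : vec) :
  (dot (cross T N) B *: v)%vec
  = comb T N B (dot v (cross N B)) (dot v (cross B T)) (dot v (cross T N)).
Proof. vec_ring. Qed.

Lemma frame_expand (T N B v : vec) :
  frame T N B -> v = comb T N B (dot v T) (dot v N) (dot v B).
Proof.
intros F; assert (C := vec_cramer T N B v).
destruct (frame_crosses _ _ _ F) as [E1 E2], (frame_dots _ _ _ F) as [BB _].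
destruct F as [_ [_ [_ E3]]].
rewrite E1, E2, <- E3, BB, scal_1 in C; exact C.
Qed.

Lemma comb_plus (T N B : vec) (a b c a' b' c' : R) :
  (comb T N B a b c + comb T N B a' b' c')%vec = comb T N B (a + a') (b + b') (c + c').
Proof. vec_ring. Qed.

Lemma dot_comb (T N B : vec) (a b c a' b' c' : R) : frame T N B ->
  dot (comb T N B a b c) (comb T N B a' b' c') = a * a' + b * b' + c * c'.
Proof.
intros F; destruct (frame_dots _ _ _ F) as [BB [TB NB]].
destruct F as [TT [NN [TN _]]].
transitivity (a * a' * dot T T + b * b' * dot N N + c * c' * dot B B
  + (a * b' + b * a') * dot T N + (a * c' + c * a') * dot T B
  + (b * c' + c * b') * dot N B); [vec_ring|].
rewrite TT, NN, BB, TN, TB, NB; ring.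
Qed.

Lemma cross_comb (T N B : vec) (a b c a' b' c' : R) : frame T N B ->
  cross (comb T N B a b c) (comb T N B a' b' c')
  = comb T N B (b * c' - c * b') (c * a' - a * c') (a * b' - b * a').
Proof.
intros F; destruct (frame_crosses _ _ _ F) as [E1 E2].
destruct F as [_ [_ [_ E3]]].
transitivity (comb (cross N B) (cross B T) (cross T N)
  (b * c' - c * b') (c * a' - a * c') (a * b' - b * a')); [vec_ring|].
rewrite E1, E2, <- E3; reflexivity.
Qed.

(** The coordinates pick up the skew-symmetric Frenet matrix, so derivatives of the frame of the
    indicatrix become computations with three scalar functions. *)
Lemma is_vderive_comb (T N B : R -> vec) (k w a b c : R -> R) (s a' b' c' : R) :
  is_vderive T s (k s *: N s)%vec ->
  is_vderive N s (- k s *: T s + w s *: B s)%vec ->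
  is_vderive B s (- w s *: N s)%vec ->
  is_derive a s a' -> is_derive b s b' -> is_derive c s c' ->
  is_vderive (fun t => comb (T t) (N t) (B t) (a t) (b t) (c t)) s
    (comb (T s) (N s) (B s) (a' - k s * b s) (b' + k s * a s - w s * c s)
      (c' + w s * b s)).
Proof.
intros dT dN dB da db dc.
assert (D := is_vderive_plus _ _ _ _ _
  (is_vderive_plus _ _ _ _ _ (is_vderive_scal _ _ _ _ _ da dT)
    (is_vderive_scal _ _ _ _ _ db dN)) (is_vderive_scal _ _ _ _ _ dc dB)).
match type of D with is_vderive _ _ ?v =>
  replace (comb (T s) (N s) (B s) (a' - k s * b s) (b' + k s * a s - w s * c s)
      (c' + w s * b s)) with v; [exact D | vec_ring] end.
Qed.

(** * Frenet equations *)

Section Frenet.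

Variables (I : R -> Prop) (c : R -> vec).
Hypothesis hc : frenet_curve I c.

Lemma frenet_open : open I.
Proof. apply hc. Qed.

Lemma frenet_smooth : vsmooth I c.
Proof. apply vsmooth_on_vsmooth; apply hc. Qed.

Lemma tangent_smooth : vsmooth I (tangent c).
Proof. exact (vsmooth_vderive _ _ frenet_open frenet_smooth). Qed.

Lemma curvature_smooth : smooth_on I (curvature c).
Proof.
destruct hc as [_ [_ [_ pos]]]; intros n.
apply C_on_sqrt.
- intros s Is; rewrite <- vnorm_sqr.
  assert (H := pos s Is); apply Rmult_lt_0_compat; exact H.
- apply smooth_dot; apply (vsmooth_vderive _ _ frenet_open tangent_smooth).
Qed.

Lemma normal_smooth : vsmooth I (normal c).
Proof.
apply vsmooth_scal.
- intros n; apply C_on_inv; [|apply curvature_smooth].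
  intros s Is; apply Rgt_not_eq; apply hc; exact Is.
- exact (vsmooth_vderive _ _ frenet_open tangent_smooth).
Qed.

Lemma binormal_smooth : vsmooth I (binormal c).
Proof. exact (vsmooth_cross _ _ _ tangent_smooth normal_smooth). Qed.

Lemma torsion_smooth : smooth_on I (torsion c).
Proof.
intros n; apply C_on_opp; apply smooth_dot; [|exact normal_smooth].
exact (vsmooth_vderive _ _ frenet_open binormal_smooth).
Qed.

Lemma is_vderive_tangent (s : R) :
  I s -> is_vderive (tangent c) s (curvature c s *: normal c s)%vec.
Proof.
intros Is; unfold normal; rewrite scal_scal, Rinv_r, scal_1.
- exact (vsmooth_is_vderive _ _ _ tangent_smooth Is).
- apply Rgt_not_eq; apply hc; exact Is.
Qed.

(** For differentiating identities that hold on [I] only, such as the orthonormality relations. *)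
Lemma const_on_is_derive (f : R -> R) (a s l : R) :
  (forall t, I t -> f t = a) -> I s -> is_derive f s l -> l = 0.
Proof.
intros e Is d; rewrite <- (is_derive_unique f s l d).
apply is_derive_unique, (is_derive_ext_open I (fun _ => a)).
- exact frenet_open.
- exact Is.
- intros t It; symmetry; auto.
- apply (is_derive_const (V := R_NormedModule)).
Qed.

Lemma frenet_frame (s : R) :
  I s -> frame (tangent c s) (normal c s) (binormal c s).
Proof.
assert (U : forall t, I t -> dot (tangent c t) (tangent c t) = 1).
{ intros t It; rewrite <- vnorm_sqr; unfold tangent.
  destruct hc as [_ [_ [e _]]]; rewrite (e t It); ring. }
intros Is; assert (kp : 0 < curvature c s) by (apply hc; exact Is).
split; [exact (U s Is)|split; [|split; [|reflexivity]]].
- unfold normal; rewrite dot_scal_l, dot_comm, dot_scal_l, <- vnorm_sqr.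
  fold (curvature c s); field; lra.
- assert (d := vsmooth_is_vderive _ _ _ tangent_smooth Is).
  assert (Z := const_on_is_derive _ _ _ _ U Is (is_derive_dot _ _ _ _ _ d d)).
  rewrite (dot_comm (tangent c s)) in Z.
  rewrite dot_comm; unfold normal; rewrite dot_scal_l.
  replace (dot (vderive (tangent c) s) (tangent c s)) with 0 by lra; ring.
Qed.

(** Differentiating N.N = 1 and T.N = 0 fixes all coordinates of N' except the one along B, called
    [w]. The product rule for B = T x N then gives B' = -w N, which identifies [w] with the torsion
    as defined. *)
Lemma frenet_equations (s : R) : I s ->
  is_vderive (tangent c) s (curvature c s *: normal c s)%vec /\
  is_vderive (normal c) s
    (- curvature c s *: tangent c s + torsion c s *: binormal c s)%vec /\
  is_vderive (binormal c) s (- torsion c s *: normal c s)%vec.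
Proof.
intros Is; assert (F := frenet_frame s Is).
assert (dT := is_vderive_tangent s Is).
assert (dN := vsmooth_is_vderive _ _ _ normal_smooth Is).
assert (dB := is_vderive_cross _ _ _ _ _ dT dN).
change (fun t => cross (tangent c t) (normal c t)) with (binormal c) in dB.
set (N' := vderive (normal c) s) in *.
assert (e1 : dot N' (normal c s) = 0).
{ assert (Z := const_on_is_derive (fun t => dot (normal c t) (normal c t)) 1 s _
    (fun t It => proj1 (proj2 (frenet_frame t It))) Is (is_derive_dot _ _ _ _ _ dN dN)).
  rewrite (dot_comm (normal c s)) in Z; lra. }
assert (e2 : dot N' (tangent c s) = - curvature c s).
{ assert (Z := const_on_is_derive (fun t => dot (tangent c t) (normal c t)) 0 s _
    (fun t It => proj1 (proj2 (proj2 (frenet_frame t It)))) Is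
    (is_derive_dot _ _ _ _ _ dT dN)).
  rewrite dot_scal_l, (proj1 (proj2 F)), (dot_comm (tangent c s)) in Z; lra. }
assert (EN := frame_expand _ _ _ N' F); rewrite e1, e2 in EN.
set (w := dot N' (binormal c s)) in *.
assert (EB : (cross (curvature c s *: normal c s) (normal c s)
  + cross (tangent c s) N')%vec = (- w *: normal c s)%vec).
{ rewrite EN; destruct (frame_crosses _ _ _ F) as [_ E2].
  (* Only the N on the right-hand side is replaced, by B x T; both sides are then polynomials in the
     coordinates of T, N, B. *)
  rewrite <- E2 at 4; vec_ring. }
rewrite EB in dB.
assert (ew : torsion c s = w).
{ unfold torsion; rewrite (is_vderive_vderive _ _ _ dB), dot_scal_l, (proj1 (proj2 F)).
  ring. }
rewrite ew; split; [exact dT | split; [|exact dB]].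
replace (- curvature c s *: tangent c s + w *: binormal c s)%vec with N';
  [exact dN | rewrite EN; vec_ring].
Qed.

End Frenet.

(** * Monotone functions on an interval *)

Lemma is_derive_continuity_pt (F : R -> R) (s l : R) :
  is_derive F s l -> continuity_pt F s.
Proof.
intros d; apply derivable_continuous_pt; exists l.
apply is_derive_Reals; exact d.
Qed.

(** Stated without an order between [a] and [b], so that it serves decreasing functions too. *)
Lemma open_interval_IVT (I : R -> Prop) (F : R -> R) (a b y : R) :
  Defs.open_interval I -> (forall s, I s -> continuity_pt F s) ->
  I a -> I b -> F a <= y <= F b -> exists s, I s /\ F s = y.
Proof.
intros [_ [_ conv]] cF Ia Ib [[l1|e1] [l2|e2]];
  [|exists b; auto|exists a; auto|exists a; auto].
destruct (Rtotal_order a b) as [lt|[->|lt]]; [|lra|].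
- destruct (Ranalysis5.IVT_interv (fun s => F s - y) a b) as [z [Hz Ez]]; try lra.
  + intros s Hs; apply continuity_pt_minus.
    * apply cF, (conv a s b); auto.
    * apply continuity_pt_const; intros u v; reflexivity.
  + exists z; split; [apply (conv a z b); auto | lra].
- destruct (Ranalysis5.IVT_interv (fun s => y - F s) b a) as [z [Hz Ez]]; try lra.
  + intros s Hs; apply continuity_pt_minus.
    * apply continuity_pt_const; intros u v; reflexivity.
    * apply cF, (conv b s a); auto.
  + exists z; split; [apply (conv b z a); auto | lra].
Qed.

Lemma nonvanishing_sign (I : R -> Prop) (F : R -> R) :
  Defs.open_interval I -> (forall s, I s -> continuity_pt F s) ->
  (forall s, I s -> F s <> 0) -> exists e, forall s, I s -> 0 < e * F s.
Proof.
intros hI cF nz; assert (H := hI); destruct H as [[s0 I0] _].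
(* A value of [F] itself encodes the sign; by the intermediate value theorem a change of sign would
   force a zero. *)
exists (F s0); intros s Is.
assert (n0 := nz s0 I0); assert (n := nz s Is).
destruct (Rtotal_order (F s0) 0) as [l0|[?|l0]]; [|lra|];
  destruct (Rtotal_order (F s) 0) as [l|[?|l]]; try lra; try nra.
- destruct (open_interval_IVT I F s0 s 0) as [z [Iz Ez]]; auto; [lra|].
  case (nz z Iz Ez).
- destruct (open_interval_IVT I F s s0 0) as [z [Iz Ez]]; auto; [lra|].
  case (nz z Iz Ez).
Qed.

Lemma open_ball (I : R -> Prop) (s : R) :
  open I -> I s -> exists d, 0 < d /\ forall t, Rabs (t - s) < d -> I t.
Proof.
intros oI Is; destruct (oI s Is) as [d H].
exists d; split; [apply cond_pos|]; intros t ht; exact (H t ht).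
Qed.

Section Monotone.

Variables (I : R -> Prop) (F dF : R -> R) (e : R).
Hypothesis hI : Defs.open_interval I.
Hypothesis hF : forall s, I s -> is_derive F s (dF s).
Hypothesis he : forall s, I s -> 0 < e * dF s.

(** The factor [e] carries the sign of the derivative, so that both kinds of monotonicity are
    handled together: s* may increase or decrease with s, while for s_n the factor is 1. *)
Lemma open_interval_increasing (a b : R) : I a -> I b -> a < b -> e * F a < e * F b.
Proof.
intros Ia Ib lt; destruct hI as [_ [_ conv]].
destruct (MVT_gen F a b dF) as [c [Hc E]].
- intros x; rewrite Rmin_left, Rmax_right by lra; intros Hx.
  apply hF, (conv a x b); auto; lra.
- intros x; rewrite Rmin_left, Rmax_right by lra; intros Hx.
  apply (is_derive_continuity_pt F x (dF x)), hF, (conv a x b); auto.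
- rewrite Rmin_left, Rmax_right in Hc by lra.
  assert (P := he c (conv a c b Ia Ib Hc)).
  assert (e * F b - e * F a = (e * dF c) * (b - a)); [|nra].
  rewrite Rmult_assoc, <- E; ring.
Qed.

Lemma open_interval_reflects (a b : R) : I a -> I b -> e * F a < e * F b -> a < b.
Proof.
intros Ia Ib lt; destruct (Rtotal_order a b) as [l|[->|l]]; [exact l|lra|].
assert (H := open_interval_increasing b a Ib Ia l); lra.
Qed.

Lemma open_interval_image : Defs.open_interval (fun t => exists s, I s /\ F s = t).
Proof.
assert (cF : forall s, I s -> continuity_pt F s).
{ intros s Is; exact (is_derive_continuity_pt F s _ (hF s Is)). }
assert (H := hI); destruct H as [[s0 I0] [oI _]].
split; [exists (F s0), s0; auto | split].
- intros t [s [Is <-]].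
  destruct (open_ball I s oI Is) as [d [dp Hd]].
  assert (Ia : I (s - d / 2)).
  { apply Hd; replace (s - d / 2 - s) with (- (d / 2)) by ring.
    rewrite Rabs_Ropp, Rabs_pos_eq; lra. }
  assert (Ib : I (s + d / 2)).
  { apply Hd; replace (s + d / 2 - s) with (d / 2) by ring.
    rewrite Rabs_pos_eq; lra. }
  assert (La := open_interval_increasing _ _ Ia Is ltac:(lra)).
  assert (Lb := open_interval_increasing _ _ Is Ib ltac:(lra)).
  (* The absolute values make [r] positive whether [F] increases or decreases; every value within
     [r] of [F s] lies between the values at [s - d / 2] and [s + d / 2]. *)
  set (r := Rmin (Rabs (F s - F (s - d / 2))) (Rabs (F (s + d / 2) - F s))).
  assert (rp : 0 < r).
  { apply Rmin_glb_lt; apply Rabs_pos_lt; intros Z; apply Rminus_diag_uniq in Z.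
    - rewrite Z in La; lra.
    - rewrite Z in Lb; lra. }
  exists (mkposreal r rp); intros t ht; change (Rabs (t - F s) < r) in ht.
  assert (h1 := Rlt_le_trans _ _ _ ht (Rmin_l _ _)).
  assert (h2 := Rlt_le_trans _ _ _ ht (Rmin_r _ _)).
  destruct (Rtotal_order 0 e) as [ep|[z|en]]; [|rewrite <- z in La; lra|].
  + apply Rmult_lt_reg_l in La, Lb; auto.
    rewrite (Rabs_pos_eq (F s - _)) in h1 by lra.
    rewrite (Rabs_pos_eq (F _ - F s)) in h2 by lra.
    apply Rabs_def2 in h1; apply Rabs_def2 in h2.
    apply (open_interval_IVT I F (s - d / 2) (s + d / 2)); auto; lra.
  + assert (La' : F s < F (s - d / 2)) by (apply (Rmult_lt_reg_l (- e)); lra).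
    assert (Lb' : F (s + d / 2) < F s) by (apply (Rmult_lt_reg_l (- e)); lra).
    rewrite (Rabs_left1 (F s - _)) in h1 by lra.
    rewrite (Rabs_left1 (F _ - F s)) in h2 by lra.
    apply Rabs_def2 in h1; apply Rabs_def2 in h2.
    apply (open_interval_IVT I F (s + d / 2) (s - d / 2)); auto; lra.
- intros x y z [a [Ia <-]] [b [Ib <-]] H.
  exact (open_interval_IVT I F a b y hI cF Ia Ib H).
Qed.

Variables (K : R -> Prop) (p : R -> R).
Hypothesis hK : open K.
Hypothesis hp : correspondence I K F p.

(** Monotonicity traps [p y] between [p t - q] and [p t + q] as soon as [e * y] lies between the
    values of [e * F] at these two points. *)
Lemma inverse_continuous (t d : R) : K t -> 0 < d ->
  exists r, 0 < r /\ forall y, Rabs (y - t) < r -> K y /\ Rabs (p y - p t) < d.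
Proof.
intros Kt dp; destruct hp as [hIK hKI].
destruct (hKI t Kt) as [Is Et].
destruct (open_ball K t hK Kt) as [r0 [r0p Hr0]].
destruct (open_ball I (p t) (proj1 (proj2 hI)) Is) as [d0 [d0p Hd0]].
set (q := Rmin d d0 / 2).
assert (qp : 0 < q) by (unfold q; assert (0 < Rmin d d0) by (apply Rmin_glb_lt; lra); lra).
assert (qd : q < d) by (unfold q; assert (M := Rmin_l d d0); lra).
assert (qd0 : q < d0) by (unfold q; assert (M := Rmin_r d d0); lra).
assert (Ia : I (p t - q)).
{ apply Hd0; replace (p t - q - p t) with (- q) by ring.
  rewrite Rabs_Ropp, Rabs_pos_eq; lra. }
assert (Ib : I (p t + q)).
{ apply Hd0; replace (p t + q - p t) with q by ring. rewrite Rabs_pos_eq; lra. }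
assert (La := open_interval_increasing _ _ Ia Is ltac:(lra)).
assert (Lb := open_interval_increasing _ _ Is Ib ltac:(lra)).
rewrite Et in La, Lb.
set (m := Rmin (e * t - e * F (p t - q)) (e * F (p t + q) - e * t)).
assert (mp : 0 < m) by (apply Rmin_glb_lt; lra).
(* Dividing by [Rabs e + 1] instead of [Rabs e] avoids a separate argument that the divisor is
   nonzero. *)
assert (ep : 0 < Rabs e + 1) by (assert (A := Rabs_pos e); lra).
assert (ap : 0 < m / (Rabs e + 1)) by (apply Rdiv_lt_0_compat; lra).
exists (Rmin r0 (m / (Rabs e + 1))); split; [apply Rmin_glb_lt; lra|].
intros y Hy.
assert (Ky : K y) by (apply Hr0; apply (Rlt_le_trans _ _ _ Hy), Rmin_l).
split; [exact Ky|].
assert (Hm : Rabs (e * y - e * t) < m).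
{ assert (h := Rlt_le_trans _ _ _ Hy (Rmin_r _ _)).
  rewrite <- Rmult_minus_distr_l, Rabs_mult.
  apply (Rmult_lt_compat_l _ _ _ ep) in h.
  replace ((Rabs e + 1) * (m / (Rabs e + 1))) with m in h by (field; lra).
  assert (A := Rabs_pos (y - t)); lra. }
assert (m1 := Rlt_le_trans _ _ _ Hm (Rmin_l _ _)).
assert (m2 := Rlt_le_trans _ _ _ Hm (Rmin_r _ _)).
apply Rabs_def2 in m1; apply Rabs_def2 in m2.
destruct (hKI y Ky) as [Iy Ey].
assert (l1 : p t - q < p y) by (apply open_interval_reflects; auto; rewrite Ey; lra).
assert (l2 : p y < p t + q) by (apply open_interval_reflects; auto; rewrite Ey; lra).
apply Rabs_def1; lra.
Qed.

(** The difference quotient of [p] for the increment [h] is the reciprocal of that of [F] at [p t]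
    for the increment [k = p (t + h) - p t]. Continuity of [p] makes [k] small, and continuity of
    [Rinv] at [dF (p t)] transfers the limit. *)
Lemma is_derive_inverse (t : R) : K t -> is_derive p t (/ dF (p t)).
Proof.
intros Kt; assert (hKI := proj2 hp); destruct (hKI t Kt) as [Is Et].
assert (nz : dF (p t) <> 0) by (intros Z; assert (P := he _ Is); rewrite Z in P; lra).
apply is_derive_Reals; intros ep epp.
assert (cinv : continuous Rinv (dF (p t))) by (apply continuous_Rinv; exact nz).
destruct (proj1 (filterlim_locally _ _) cinv (mkposreal ep epp)) as [eta Heta].
destruct (proj1 (is_derive_Reals _ _ _) (hF _ Is) eta (cond_pos eta)) as [d1 Hd1].
destruct (inverse_continuous t d1 Kt (cond_pos d1)) as [r [rp Hr]].
exists (mkposreal r rp); intros h hn hh; cbn in hh.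
destruct (Hr (t + h)) as [Kh Ph].
{ replace (t + h - t) with h by ring; exact hh. }
destruct (hKI _ Kh) as [Ih Eh].
set (k := p (t + h) - p t) in *.
assert (kn : k <> 0).
{ intros Z; apply hn; assert (Z' : p (t + h) = p t) by (unfold k in Z; lra).
  rewrite Z', Et in Eh; lra. }
assert (Q := Hd1 k kn Ph).
replace (p t + k) with (p (t + h)) in Q by (unfold k; ring).
rewrite Eh, Et in Q; replace (t + h - t) with h in Q by ring.
assert (Q' := Heta (h / k) Q); change (Rabs (/ (h / k) - / dF (p t)) < ep) in Q'.
replace (/ (h / k)) with (k / h) in Q' by (field; auto).
exact Q'.
Qed.

End Monotone.

(** * Bertrand mates *)

Lemma const_open_interval (I : R -> Prop) (F : R -> R) :
  Defs.open_interval I -> (forall s, I s -> is_derive F s 0) ->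
  exists a, forall s, I s -> F s = a.
Proof.
intros [[s0 I0] [_ conv]] d; exists (F s0); intros s Is.
assert (M : forall x, Rmin s0 s <= x <= Rmax s0 s -> is_derive F x 0).
{ intros x Hx; apply d.
  unfold Rmin, Rmax in Hx; destruct (Rle_dec s0 s);
    [apply (conv s0 x s) | apply (conv s x s0)]; auto. }
destruct (MVT_gen F s0 s (fun _ => 0)) as [c [_ E]].
- intros x Hx; apply M; lra.
- intros x Hx; exact (is_derive_continuity_pt F x 0 (M x Hx)).
- lra.
Qed.

Section Bertrand.

Variables (I J : R -> Prop) (c d : R -> vec) (phi psi dphi : R -> R) (eps : R).
Hypothesis hb : bertrand_mate I c J d phi psi eps.
Hypothesis hphi : forall s, I s -> is_derive phi s (dphi s).

(** The derivative of the mate's tangent points along the mate's normal, which is parallel to that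
    of [c]. Only the direction matters below, hence the unspecified [m]. *)
Lemma bertrand_tangent_derive (s : R) : I s ->
  exists m, is_vderive (fun t => tangent d (phi t)) s (m *: normal c s)%vec.
Proof.
intros Is; destruct hb as [hc [hd [[hIJ _] [he [hN _]]]]].
destruct (hIJ s Is) as [Js _].
exists (dphi s * curvature d (phi s) * eps).
assert (D := is_vderive_comp _ _ _ _ _ (is_vderive_tangent J d hd _ Js) (hphi s Is)).
rewrite (hN s Is), scal_scal.
replace (dphi s * curvature d (phi s) * eps * eps) with (dphi s * curvature d (phi s)).
- rewrite <- scal_scal; exact D.
- destruct he as [-> | ->]; ring.
Qed.

Lemma bertrand_tangent_normal (s : R) :
  I s -> dot (tangent d (phi s)) (normal c s) = 0.
Proof.
intros Is; destruct hb as [hc [hd [[hIJ _] [_ [hN _]]]]].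
destruct (hIJ s Is) as [Js _].
rewrite (hN s Is), dot_comm, dot_scal_l, dot_comm.
rewrite (proj1 (proj2 (proj2 (frenet_frame J d hd _ Js)))); ring.
Qed.

(** Both terms of each derivative vanish: the mate's tangent varies along N, which is orthogonal to
    T and B, while T' and B' are multiples of N, to which the mate's tangent is orthogonal. *)
Lemma bertrand_angle_const : exists a b, forall s, I s ->
  dot (tangent d (phi s)) (tangent c s) = a /\
  dot (tangent d (phi s)) (binormal c s) = b.
Proof.
assert (hc : frenet_curve I c) by apply hb.
assert (hI : Defs.open_interval I) by apply hc.
destruct (const_open_interval I (fun s => dot (tangent d (phi s)) (tangent c s)) hI)
  as [a Ha].
{ intros s Is; destruct (bertrand_tangent_derive s Is) as [m dU].
  destruct (frenet_equations I c hc s Is) as [dT _].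
  apply (is_derive_eq _ _ _ _ (is_derive_dot _ _ _ _ _ dU dT)).
  rewrite dot_scal_l, (dot_comm _ (_ *: _)%vec), dot_scal_l, (dot_comm _ (tangent d _)).
  rewrite bertrand_tangent_normal by exact Is.
  rewrite dot_comm, (proj1 (proj2 (proj2 (frenet_frame I c hc s Is)))); ring. }
destruct (const_open_interval I (fun s => dot (tangent d (phi s)) (binormal c s)) hI)
  as [b Hb].
{ intros s Is; destruct (bertrand_tangent_derive s Is) as [m dU].
  destruct (frenet_equations I c hc s Is) as [_ [_ dB]].
  apply (is_derive_eq _ _ _ _ (is_derive_dot _ _ _ _ _ dU dB)).
  rewrite dot_scal_l, (dot_comm _ (_ *: _)%vec), dot_scal_l, (dot_comm _ (tangent d _)).
  rewrite bertrand_tangent_normal by exact Is.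
  rewrite (proj2 (proj2 (frame_dots _ _ _ (frenet_frame I c hc s Is)))); ring. }
exists a, b; auto.
Qed.

(** The derivative of [d (phi s)] is (1 - l kappa) T + l tau B. Its components along T and B are
    also [dphi s * a] and [dphi s * b], with the constants [a], [b] of the previous lemma. *)
Lemma bertrand_torsion_affine :
  (forall s, I s -> dphi s <> 0) -> (forall s, I s -> torsion c s <> 0) ->
  (forall s, I s -> Derive (curvature c) s <> 0) ->
  exists G, forall s, I s -> Derive (torsion c) s = G * Derive (curvature c) s.
Proof.
intros dn tn kn; assert (hc : frenet_curve I c) by apply hb.
assert (hI : Defs.open_interval I) by apply hc.
destruct bertrand_angle_const as [a [b Hab]].
destruct hb as [_ [hd [[hIJ _] [_ [_ [l [ln Hl]]]]]]].
assert (E : forall s, I s ->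
  dphi s * a = 1 - l * curvature c s /\ dphi s * b = l * torsion c s).
{ intros s Is; destruct (hIJ s Is) as [Js _].
  assert (oI : open I) by apply hI.
  assert (D1 := is_vderive_comp _ _ _ _ _
    (vsmooth_is_vderive J d _ (frenet_smooth J d hd) Js) (hphi s Is)).
  apply (is_vderive_ext_open I _ _ s _ oI Is Hl) in D1.
  destruct (frenet_equations I c hc s Is) as [_ [dN _]].
  assert (D2 := is_vderive_plus _ _ _ _ _
    (vsmooth_is_vderive I c _ (frenet_smooth I c hc) Is)
    (is_vderive_scal _ _ _ _ _ (is_derive_const (V := R_NormedModule) l s) dN)).
  assert (V := eq_trans (eq_sym (is_vderive_vderive _ _ _ D1)) (is_vderive_vderive _ _ _ D2)).
  change (vderive d (phi s)) with (tangent d (phi s)) in V.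
  change (vderive c s) with (tangent c s) in V.
  assert (V' : (dphi s *: tangent d (phi s))%vec
    = comb (tangent c s) (normal c s) (binormal c s)
        (1 - l * curvature c s) 0 (l * torsion c s)).
  { rewrite V; change (@zero R_NormedModule) with 0; vec_ring. }
  destruct (Hab s Is) as [<- <-].
  rewrite <- !dot_scal_l, V'.
  assert (F := frenet_frame I c hc s Is).
  split;
    [transitivity (dot (comb (tangent c s) (normal c s) (binormal c s)
        (1 - l * curvature c s) 0 (l * torsion c s))
      (comb (tangent c s) (normal c s) (binormal c s) 1 0 0))
    |transitivity (dot (comb (tangent c s) (normal c s) (binormal c s)
        (1 - l * curvature c s) 0 (l * torsion c s))
      (comb (tangent c s) (normal c s) (binormal c s) 0 0 1))];
    [f_equal; vec_ring | rewrite dot_comb by exact F; ring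
    |f_equal; vec_ring | rewrite dot_comb by exact F; ring]. }
(* Eliminates [dphi] between the two equations, leaving an affine relation with constant
   coefficients. *)
assert (Q : forall s, I s ->
  a * (l * torsion c s) + b * l * curvature c s = b).
{ intros s Is; destruct (E s Is) as [E1 E2].
  rewrite <- E2; replace (b * l * curvature c s) with (b * (1 - dphi s * a)); [ring|].
  rewrite E1; ring. }
assert (Q' : forall s, I s ->
  a * Derive (torsion c) s + b * Derive (curvature c) s = 0).
{ intros s Is.
  assert (dt := smooth_on_is_derive I _ s (torsion_smooth I c hc) Is).
  assert (dk := smooth_on_is_derive I _ s (curvature_smooth I c hc) Is).
  assert (S := is_derive_plus _ _ _ _ _
    (is_derive_scal _ _ a _ (is_derive_scal _ _ l _ dt))
    (is_derive_scal _ _ (b * l) _ dk)).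
  apply (const_on_is_derive I c hc _ b s _ Q Is) in S.
  unfold plus in S; cbn in S; apply (Rmult_eq_reg_l l); [|exact ln].
  rewrite Rmult_0_r; refine (eq_trans _ S); ring. }
destruct hI as [[s0 I0] _].
(* If [a] vanished, kappa' being nonzero would force [b = 0], and then l tau = [dphi * b] would
   vanish as well. *)
assert (an : a <> 0).
{ intros Z; assert (q := Q' s0 I0); rewrite Z in q.
  destruct (E s0 I0) as [_ E2]; assert (tn0 := tn s0 I0); assert (kn0 := kn s0 I0).
  assert (b = 0) by (apply (Rmult_eq_reg_r (Derive (curvature c) s0)); [lra|exact kn0]).
  apply (Rmult_integral_contrapositive_currified _ _ ln tn0); rewrite <- E2; subst b; ring. }
exists (- b / a); intros s Is; assert (q := Q' s Is).
apply (Rmult_eq_reg_l a); [|exact an].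
field_simplify; [lra | exact an].
Qed.

End Bertrand.

(** * The principal normal indicatrix *)

Section Indicatrix.

Variables (I : R -> Prop) (c : R -> vec) (G e : R).
Hypothesis hc : frenet_curve I c.
Hypothesis hG : forall s, I s -> Derive (torsion c) s = G * Derive (curvature c) s.
Hypothesis he : e * e = 1.

Let k := curvature c.
Let f (s : R) := torsion c s / k s.
(* [k * relspeed] is the speed of [normal c]. *)
Let relspeed (s : R) := sqrt (1 + f s ^ 2).
(** This is [k] times the derivative of [f]. *)
Let a (s : R) := Derive k s * (G - f s).
(** On [I], [sigma s * relspeed s] is the length of the unnormalized principal normal that appears
    in [Nn] below. *)
Let sigma (s : R) := sqrt ((Derive k s) ^ 2 * (G - f s) ^ 2 + k s ^ 4 * (1 + f s ^ 2) ^ 3).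
Let in_frame (s x y z : R) := comb (tangent c s) (normal c s) (binormal c s) x y z.

Lemma frenet_curvature_pos (s : R) : I s -> 0 < k s.
Proof. apply hc. Qed.

Lemma relspeed_pos (s : R) : 0 < relspeed s.
Proof. apply sqrt_lt_R0; nra. Qed.

Lemma relspeed_sqr (s : R) : relspeed s ^ 2 = 1 + f s ^ 2.
Proof. apply pow2_sqrt; nra. Qed.

Lemma sigma_arg_pos (s : R) : I s ->
  0 < (Derive k s) ^ 2 * (G - f s) ^ 2 + k s ^ 4 * (1 + f s ^ 2) ^ 3.
Proof.
intros Is; apply Rplus_le_lt_0_compat.
- apply Rmult_le_pos; apply pow2_ge_0.
- apply Rmult_lt_0_compat; apply pow_lt; [apply frenet_curvature_pos; exact Is | nra].
Qed.

Lemma sigma_pos (s : R) : I s -> 0 < sigma s.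
Proof. intros Is; apply sqrt_lt_R0, sigma_arg_pos, Is. Qed.

Lemma sigma_sqr (s : R) : I s -> sigma s ^ 2 = a s ^ 2 + k s ^ 4 * relspeed s ^ 6.
Proof.
intros Is; unfold sigma; rewrite pow2_sqrt by (apply Rlt_le, sigma_arg_pos, Is).
replace (relspeed s ^ 6) with ((relspeed s ^ 2) ^ 3) by ring; rewrite relspeed_sqr; unfold a; ring.
Qed.

Lemma is_derive_curvature (s : R) : I s -> is_derive k s (Derive k s).
Proof. apply smooth_on_is_derive, curvature_smooth, hc. Qed.

Lemma is_derive_curvature_Derive (s : R) : I s -> is_derive (Derive k) s (Derive_n k 2 s).
Proof.
apply (smooth_on_is_derive I (Derive k)), smooth_on_Derive; [apply hc|].
apply curvature_smooth, hc.
Qed.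

Lemma is_derive_ratio (s : R) : I s -> is_derive f s (a s / k s).
Proof.
intros Is; assert (kp := frenet_curvature_pos s Is).
assert (dt := smooth_on_is_derive I _ s (torsion_smooth I c hc) Is).
apply (is_derive_eq _ _ _ _
  (is_derive_div _ _ _ _ _ dt (is_derive_curvature s Is) (Rgt_not_eq _ _ kp))).
rewrite hG by exact Is; fold k; unfold a, f; field; lra.
Qed.

Lemma ratio_smooth : smooth_on I f.
Proof.
intros n; apply C_on_mult; [apply torsion_smooth, hc|].
apply C_on_inv; [|apply curvature_smooth, hc].
intros s Is; apply Rgt_not_eq, frenet_curvature_pos, Is.
Qed.

Lemma relspeed_smooth : smooth_on I relspeed.
Proof.
intros n; apply C_on_sqrt; [intros s _; nra|].
apply C_on_plus; [apply C_on_const | apply C_on_pow, ratio_smooth].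
Qed.

Lemma speed_inv_smooth : smooth_on I (fun s => / (k s * relspeed s)).
Proof.
intros n; apply C_on_inv.
- intros s Is; apply Rgt_not_eq, Rmult_lt_0_compat; [apply frenet_curvature_pos, Is | apply relspeed_pos].
- apply C_on_mult; [apply curvature_smooth, hc | apply relspeed_smooth].
Qed.

Lemma is_derive_relspeed (s : R) : I s -> is_derive relspeed s (f s * a s / (k s * relspeed s)).
Proof.
intros Is; assert (kp := frenet_curvature_pos s Is).
assert (wp := relspeed_pos s).
assert (df := is_derive_ratio s Is).
assert (D : is_derive (fun t => 1 + f t ^ 2) s (2 * f s * (a s / k s))).
{ apply (is_derive_eq _ _ _ _ (is_derive_plus _ _ _ _ _
    (is_derive_const (V := R_NormedModule) 1 s) (is_derive_pow _ 2 _ _ df))).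
  unfold plus, zero; cbn; ring. }
apply (is_derive_eq _ _ _ _ (is_derive_sqrt _ _ _ D ltac:(nra))).
fold (relspeed s); field; lra.
Qed.

Lemma is_derive_relspeed_inv (s : R) :
  I s -> is_derive (fun t => / relspeed t) s (- (f s * a s) / (k s * relspeed s ^ 3)).
Proof.
intros Is; assert (kp := frenet_curvature_pos s Is).
assert (wp := relspeed_pos s).
apply (is_derive_eq _ _ _ _ (is_derive_inv _ _ _ (is_derive_relspeed s Is) ltac:(lra))).
field; lra.
Qed.

Lemma is_derive_ratio_div_relspeed (s : R) :
  I s -> is_derive (fun t => f t * / relspeed t) s (a s / (k s * relspeed s ^ 3)).
Proof.
intros Is; assert (kp := frenet_curvature_pos s Is).
assert (wp := relspeed_pos s).
apply (is_derive_eq _ _ _ _ (is_derive_Rmult _ _ _ _ _ (is_derive_ratio s Is) (is_derive_relspeed_inv s Is))).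
transitivity (a s * (relspeed s ^ 2 - f s ^ 2) / (k s * relspeed s ^ 3)); [field; lra|].
rewrite relspeed_sqr; field; lra.
Qed.

Lemma frenet_frame_at (s : R) : I s -> frame (tangent c s) (normal c s) (binormal c s).
Proof. apply frenet_frame, hc. Qed.

Lemma is_vderive_in_frame (x y z : R -> R) (s x' y' z' : R) : I s ->
  is_derive x s x' -> is_derive y s y' -> is_derive z s z' ->
  is_vderive (fun t => in_frame t (x t) (y t) (z t)) s
    (in_frame s (x' - k s * y s) (y' + k s * x s - torsion c s * z s)
      (z' + torsion c s * y s)).
Proof.
intros Is dx dy dz; destruct (frenet_equations I c hc s Is) as [dT [dN dB]].
exact (is_vderive_comb _ _ _ k (torsion c) x y z s x' y' z' dT dN dB dx dy dz).
Qed.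

Lemma torsion_ratio (s : R) : I s -> torsion c s = f s * k s.
Proof. intros Is; assert (kp := frenet_curvature_pos s Is); unfold f; field; lra. Qed.

Lemma in_frame_scal (s r x y z : R) : (r *: in_frame s x y z)%vec = in_frame s (r * x) (r * y) (r * z).
Proof. unfold in_frame; vec_ring. Qed.

(** The claimed frame, still as functions of the parameter of [c]. Powers of [relspeed] stand for
    those of 1 + f^2, so that [field] meets an indeterminate instead of a root. *)
Let Tn (s : R) := in_frame s (- e * / relspeed s) 0 (e * (f s * / relspeed s)).
Let Nn (s : R) :=
  ((e / (sigma s * relspeed s)) *: in_frame s (f s * a s) (- (k s ^ 2 * relspeed s ^ 4)) (a s))%vec.
Let Bn (s : R) :=
  (/ sigma s *: in_frame s (f s * (k s ^ 2 * relspeed s ^ 2)) (a s) (k s ^ 2 * relspeed s ^ 2))%vec.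
Let kn (s : R) := sigma s / (k s ^ 2 * relspeed s ^ 3).

Lemma is_vderive_normal_scal (s : R) : I s ->
  is_vderive (fun t => (e *: normal c t)%vec) s ((k s * relspeed s) *: Tn s)%vec.
Proof.
intros Is; assert (kp := frenet_curvature_pos s Is).
assert (wp := relspeed_pos s).
assert (D := is_vderive_in_frame (fun _ => 0) (fun _ => e) (fun _ => 0) s 0 0 0 Is
  (is_derive_const (V := R_NormedModule) 0 s) (is_derive_const (V := R_NormedModule) e s)
  (is_derive_const (V := R_NormedModule) 0 s)).
apply (is_vderive_ext_open I _ (fun t => (e *: normal c t)%vec)) in D;
  [|apply hc | exact Is | intros t _; unfold in_frame; vec_ring].
unfold Tn; rewrite in_frame_scal; revert D; rewrite torsion_ratio by exact Is.
match goal with |- is_vderive _ _ ?u -> is_vderive _ _ ?v => replace v with u; [auto|] end.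
f_equal; field; lra.
Qed.

Lemma is_vderive_Tn (s : R) : I s ->
  is_vderive Tn s ((k s * relspeed s * kn s) *: Nn s)%vec.
Proof.
intros Is; assert (kp := frenet_curvature_pos s Is).
assert (wp := relspeed_pos s); assert (sp := sigma_pos s Is).
assert (D := is_vderive_in_frame _ _ _ s _ _ _ Is
  (is_derive_scal _ _ (- e) _ (is_derive_relspeed_inv s Is))
  (is_derive_const (V := R_NormedModule) 0 s)
  (is_derive_scal _ _ e _ (is_derive_ratio_div_relspeed s Is))).
unfold Nn; rewrite scal_scal, in_frame_scal; revert D; rewrite torsion_ratio by exact Is.
match goal with |- is_vderive _ _ ?u -> is_vderive _ _ ?v => replace v with u; [auto|] end.
change (@zero R_NormedModule) with 0; unfold kn.
f_equal.
- field; lra.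
(* Only the component along N needs the relation between [relspeed] and [f]. *)
- transitivity (- (e * k s * (1 + f s ^ 2) / relspeed s)); [field; lra|].
  rewrite <- relspeed_sqr; field; lra.
- field; lra.
Qed.

Lemma dot_Nn_Nn (s : R) : I s -> dot (Nn s) (Nn s) = 1.
Proof.
intros Is.
assert (wp := relspeed_pos s); assert (sp := sigma_pos s Is).
unfold Nn, in_frame; rewrite dot_scal_l, dot_comm, dot_scal_l, dot_comb by (apply frenet_frame_at, Is).
transitivity ((e * e) * (a s ^ 2 * (1 + f s ^ 2) + k s ^ 4 * relspeed s ^ 8) / (sigma s ^ 2 * relspeed s ^ 2));
  [field; lra|].
rewrite he, <- relspeed_sqr.
transitivity ((a s ^ 2 + k s ^ 4 * relspeed s ^ 6) / sigma s ^ 2); [field; lra|].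
rewrite <- sigma_sqr by exact Is; field; lra.
Qed.

Lemma dot_Tn_Tn (s : R) : I s -> dot (Tn s) (Tn s) = 1.
Proof.
intros Is.
assert (wp := relspeed_pos s).
unfold Tn, in_frame; rewrite dot_comb by (apply frenet_frame_at, Is).
transitivity ((e * e) * (1 + f s ^ 2) / relspeed s ^ 2); [field; lra|].
rewrite he, <- relspeed_sqr; field; lra.
Qed.

Lemma cross_Tn_Nn (s : R) : I s -> cross (Tn s) (Nn s) = Bn s.
Proof.
intros Is.
assert (wp := relspeed_pos s); assert (sp := sigma_pos s Is).
unfold Tn, Nn, Bn; rewrite !in_frame_scal; unfold in_frame; rewrite cross_comb by (apply frenet_frame_at, Is).
f_equal.
- transitivity ((e * e) * (f s * (k s ^ 2 * relspeed s ^ 2)) / sigma s); [field; lra|].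
  rewrite he; field; lra.
- transitivity ((e * e) * (1 + f s ^ 2) * a s / (sigma s * relspeed s ^ 2)); [field; lra|].
  rewrite he, <- relspeed_sqr; field; lra.
- transitivity ((e * e) * (k s ^ 2 * relspeed s ^ 2) / sigma s); [field; lra|].
  rewrite he; field; lra.
Qed.

Lemma sigma_smooth : smooth_on I sigma.
Proof.
intros n; apply C_on_sqrt; [exact sigma_arg_pos|].
assert (kS := curvature_smooth I c hc).
assert (fS := ratio_smooth n).
apply C_on_plus; apply C_on_mult; apply C_on_pow.
- apply smooth_on_Derive; [apply hc | exact kS].
- apply C_on_plus; [apply C_on_const | apply C_on_opp, fS].
- apply kS.
- apply C_on_plus; [apply C_on_const | apply C_on_pow, fS].
Qed.

(* The factor [1 / sigma] of [Bn] may be treated as a constant, since [Bn] is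
   orthogonal to [Nn]. *)
Lemma is_vderive_Bn (s : R) : I s -> exists v, is_vderive Bn s v /\
  dot v (Nn s) = e * k s * relspeed s * (G - f s) / sigma s ^ 2 *
    (3 * f s * Derive k s ^ 2 * (G - f s)
     + (3 * Derive k s ^ 2 - k s * Derive_n k 2 s) * (1 + f s ^ 2)).
Proof.
intros Is; assert (kp := frenet_curvature_pos s Is).
assert (wp := relspeed_pos s); assert (sp := sigma_pos s Is).
assert (df := is_derive_ratio s Is).
assert (dr : is_derive (fun t => / sigma t) s (Derive (fun t => / sigma t) s)).
{ apply (smooth_on_is_derive I); [|exact Is].
  intros n; apply C_on_inv; [|apply sigma_smooth].
  intros t It; apply Rgt_not_eq, sigma_pos, It. }
set (r' := Derive _ s) in dr.
assert (dq : is_derive (fun t => k t ^ 2 * relspeed t ^ 2) s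
  (2 * k s * Derive k s * relspeed s ^ 2 + 2 * k s * f s * a s)).
{ apply (is_derive_eq _ _ _ _ (is_derive_Rmult _ _ _ _ _
    (is_derive_pow _ 2 _ _ (is_derive_curvature s Is)) (is_derive_pow _ 2 _ _ (is_derive_relspeed s Is)))).
  cbn; field; lra. }
(* The constancy of [G] enters here: there is no term with a derivative of [G]. *)
assert (da : is_derive a s
  (Derive_n k 2 s * (G - f s) - Derive k s * (a s / k s))).
{ apply (is_derive_eq _ _ _ _ (is_derive_Rmult _ _ _ _ _ (is_derive_curvature_Derive s Is)
    (is_derive_minus _ _ _ _ _ (is_derive_const (V := R_NormedModule) G s) df))).
  unfold minus, plus, opp, zero; cbn; ring. }
assert (D := is_vderive_scal _ _ _ _ _ dr
  (is_vderive_in_frame _ _ _ s _ _ _ Is (is_derive_Rmult _ _ _ _ _ df dq) da dq)).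
eexists; split; [exact D|].
rewrite torsion_ratio, !in_frame_scal by exact Is; unfold Nn; rewrite in_frame_scal; unfold in_frame.
rewrite comb_plus, dot_comb by (apply frenet_frame_at, Is).
rewrite <- relspeed_sqr.
(* The two sides differ by a multiple of [1 + f s ^ 2 - relspeed s ^ 2]. With the cofactor written
   out, [field] needs no relation between [f] and [relspeed]; all terms in [r'] sit in that
   multiple. *)
transitivity ((r' * e / (sigma s * relspeed s) * a s * k s ^ 2 * relspeed s ^ 2
    + e / (sigma s ^ 2 * relspeed s) * a s * (2 * k s * Derive k s * relspeed s ^ 2 + 2 * k s * f s * a s))
    * (1 + f s ^ 2 - relspeed s ^ 2)
  + e * k s * relspeed s * (G - f s) / sigma s ^ 2 *
    (3 * f s * Derive k s ^ 2 * (G - f s)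
     + (3 * Derive k s ^ 2 - k s * Derive_n k 2 s) * relspeed s ^ 2)).
- unfold a; field; lra.
- rewrite relspeed_sqr; ring.
Qed.

(** * The indicatrix in its arclength parameter *)

Variables (K : R -> Prop) (p : R -> R) (alpha : R -> vec).
Hypothesis hK : Defs.open_interval K.
Hypothesis hpI : forall t, K t -> I (p t).
Hypothesis hp : forall t, K t -> is_derive p t (/ (k (p t) * relspeed (p t))).
Hypothesis halpha : forall t, K t -> alpha t = (e *: normal c (p t))%vec.

Lemma indicatrix_smooth : vsmooth K alpha.
Proof.
assert (S : vsmooth K (fun t => (e *: normal c (p t))%vec)).
{ apply (vsmooth_flow I K p _ (fun s => (e *: normal c s)%vec) hpI hp speed_inv_smooth).
  apply vsmooth_scal; [intros n; apply C_on_const | apply normal_smooth, hc]. }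
revert S; apply vsmooth_ext; [apply hK | intros t Kt; symmetry; auto].
Qed.

Lemma indicatrix_tangent (t : R) : K t -> tangent alpha t = Tn (p t).
Proof.
intros Kt; assert (Is := hpI t Kt); assert (kp := frenet_curvature_pos _ Is).
assert (wp := relspeed_pos (p t)).
apply is_vderive_vderive, (is_vderive_ext_open K (fun t => (e *: normal c (p t))%vec));
  [apply hK | exact Kt | intros r Kr; symmetry; auto |].
assert (D := is_vderive_comp _ _ _ _ _ (is_vderive_normal_scal _ Is) (hp t Kt)).
rewrite scal_scal, Rinv_l, scal_1 in D; [exact D | nra].
Qed.

Lemma indicatrix_tangent_derive (t : R) :
  K t -> vderive (tangent alpha) t = (kn (p t) *: Nn (p t))%vec.
Proof.
intros Kt; assert (Is := hpI t Kt); assert (kp := frenet_curvature_pos _ Is).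
assert (wp := relspeed_pos (p t)).
apply is_vderive_vderive, (is_vderive_ext_open K (fun t => Tn (p t)));
  [apply hK | exact Kt | intros r Kr; symmetry; apply indicatrix_tangent, Kr |].
assert (D := is_vderive_comp _ _ _ _ _ (is_vderive_Tn _ Is) (hp t Kt)).
rewrite scal_scal, <- Rmult_assoc, Rinv_l, Rmult_1_l in D; [exact D | nra].
Qed.

Lemma kn_pos (s : R) : I s -> 0 < kn s.
Proof.
intros Is; apply Rdiv_lt_0_compat; [exact (sigma_pos s Is)|].
apply Rmult_lt_0_compat; apply pow_lt; [exact (frenet_curvature_pos s Is) | apply relspeed_pos].
Qed.

Lemma indicatrix_curvature (t : R) : K t -> curvature alpha t = kn (p t).
Proof.
intros Kt; assert (Is := hpI t Kt); assert (P := kn_pos _ Is).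
unfold curvature, vnorm; rewrite indicatrix_tangent_derive by exact Kt.
rewrite dot_scal_l, dot_comm, dot_scal_l, dot_Nn_Nn, Rmult_1_r by exact Is.
apply sqrt_square; lra.
Qed.

Lemma indicatrix_normal (t : R) : K t -> normal alpha t = Nn (p t).
Proof.
intros Kt; assert (P := kn_pos _ (hpI t Kt)).
unfold normal; rewrite indicatrix_tangent_derive, indicatrix_curvature by exact Kt.
rewrite scal_scal, Rinv_l, scal_1; [reflexivity | lra].
Qed.

Lemma indicatrix_binormal (t : R) : K t -> binormal alpha t = Bn (p t).
Proof.
intros Kt; unfold binormal; rewrite indicatrix_tangent, indicatrix_normal by exact Kt.
apply cross_Tn_Nn, hpI, Kt.
Qed.

Lemma indicatrix_torsion (t : R) : K t -> let s := p t in
  torsion alpha t = - e * (G - f s) / sigma s ^ 2 *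
    (3 * f s * Derive k s ^ 2 * (G - f s)
     + (3 * Derive k s ^ 2 - k s * Derive_n k 2 s) * (1 + f s ^ 2)).
Proof.
intros Kt s; assert (Is := hpI t Kt); fold s in Is.
assert (kp := frenet_curvature_pos _ Is).
assert (wp := relspeed_pos s); assert (sp := sigma_pos s Is).
destruct (is_vderive_Bn s Is) as [v [dv Ev]].
assert (D := is_vderive_comp _ _ _ _ _ dv (hp t Kt)).
apply (is_vderive_ext_open K _ (binormal alpha)) in D;
  [|apply hK | exact Kt | intros r Kr; symmetry; apply indicatrix_binormal, Kr].
unfold torsion at 1.
rewrite (is_vderive_vderive _ _ _ D), indicatrix_normal, dot_scal_l by exact Kt.
fold s; rewrite Ev; field; lra.
Qed.

Lemma indicatrix_frenet_curve : frenet_curve K alpha.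
Proof.
split; [exact hK | split; [|split]].
- apply vsmooth_vsmooth_on; [apply hK | exact indicatrix_smooth].
- intros t Kt; change (vderive alpha t) with (tangent alpha t).
  unfold vnorm; rewrite indicatrix_tangent, dot_Tn_Tn by auto; exact sqrt_1.
- intros t Kt; rewrite indicatrix_curvature by exact Kt; apply kn_pos, hpI, Kt.
Qed.

Lemma indicatrix_frenet_apparatus (t : R) : K t ->
  let s := p t in
  let T := tangent c s in
  let N := normal c s in
  let B := binormal c s in
  let k' := Derive k s in
  let k'' := Derive_n k 2 s in
  let kt := curvature alpha t in
  let tt := torsion alpha t in
  alpha t = (e *: N)%vec /\
  tangent alpha t = ((- e / sqrt (1 + f s ^ 2)) *: (T - f s *: B))%vec /\
  normal alpha t = ((e / (sigma s * sqrt (1 + f s ^ 2))) *: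
           ((f s * k' * (G - f s)) *: T
            - (k s ^ 2 * (1 + f s ^ 2) ^ 2) *: N
            + (k' * (G - f s)) *: B))%vec /\
  binormal alpha t = ((1 / sigma s) *:
           ((f s * k s ^ 2 * (1 + f s ^ 2)) *: T
            + (k' * (G - f s)) *: N
            + (k s ^ 2 * (1 + f s ^ 2)) *: B))%vec /\
  is_derive (tangent alpha) t (kt *: normal alpha t)%vec /\
  is_derive (normal alpha) t ((- kt) *: tangent alpha t + tt *: binormal alpha t)%vec /\
  is_derive (binormal alpha) t ((- tt) *: normal alpha t)%vec /\
  kt = sigma s / (k s ^ 2 * Rpower (1 + f s ^ 2) (3 / 2)) /\
  tt = - e * (G - f s) / sigma s ^ 2 *
       (3 * f s * k' ^ 2 * (G - f s) + (3 * k' ^ 2 - k s * k'') * (1 + f s ^ 2)).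
Proof.
intros Kt s T N B k' k'' kt tt; assert (Is := hpI t Kt); fold s in Is.
assert (wp := relspeed_pos s); assert (sp := sigma_pos s Is).
destruct (frenet_equations K alpha indicatrix_frenet_curve t Kt) as [dT [dN dB]].
fold (relspeed s).
split; [exact (halpha t Kt)|split; [|split; [|split; [|split; [|split; [|split; [|split]]]]]]].
- rewrite indicatrix_tangent by exact Kt; fold s; unfold Tn, in_frame, T, B.
  unfold Rdiv; vec_ring.
- rewrite indicatrix_normal by exact Kt; fold s; unfold Nn, in_frame, T, N, B.
  rewrite <- relspeed_sqr; f_equal; unfold a; fold k'; vec_ring.
- rewrite indicatrix_binormal by exact Kt; fold s; unfold Bn, in_frame, T, N, B.
  rewrite <- relspeed_sqr; unfold Rdiv; rewrite Rmult_1_l; f_equal; unfold a; fold k'; vec_ring.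
- apply is_vderive_is_derive, dT.
- apply is_vderive_is_derive, dN.
- apply is_vderive_is_derive, dB.
- unfold kt; rewrite indicatrix_curvature by exact Kt; fold s; unfold kn.
  (* Splits the power into 1 + f^2 times its square root, that is [relspeed s ^ 3]. *)
  replace (3 / 2) with (1 + / 2) by lra.
  rewrite Rpower_plus, Rpower_1, Rpower_sqrt by nra; fold (relspeed s).
  rewrite <- relspeed_sqr; do 2 f_equal; ring.
- exact (indicatrix_torsion t Kt).
Qed.

End Indicatrix.

(** * Construction of the arclength parameter, and conclusion *)

Lemma image_correspondence (I : R -> Prop) (F : R -> R) :
  (forall a b, I a -> I b -> F a = F b -> a = b) ->
  exists p, correspondence I (fun t => exists s, I s /\ F s = t) F p.
Proof.
(* A chosen preimage; outside the image its value is arbitrary. *)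
intros inj; exists (fun t => epsilon (inhabits 0) (fun s => I s /\ F s = t)).
assert (S : forall t, (exists s, I s /\ F s = t) ->
  I (epsilon (inhabits 0) (fun s => I s /\ F s = t)) /\
  F (epsilon (inhabits 0) (fun s => I s /\ F s = t)) = t).
{ intros t Ht; exact (epsilon_spec (inhabits 0) _ Ht). }
split; [|exact S].
intros s Is; assert (K : exists r, I r /\ F r = F s) by (exists s; auto).
split; [exact K|]; destruct (S _ K); apply inj; assumption.
Qed.

(** The constant [c0] accounts for the indefinite integral that defines s_n; convexity of [J] keeps
    the range of integration where [h] is continuous. *)
Lemma is_derive_RInt_open_interval (J : R -> Prop) (h : R -> R) (u0 u c0 : R) :
  Defs.open_interval J -> (forall v, J v -> continuous h v) -> J u0 -> J u ->
  is_derive (fun v => c0 + RInt h u0 v) u (h u).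
Proof.
intros [_ [oJ conv]] ch J0 Ju.
assert (D : is_derive (RInt h u0) u (h u)).
{ apply (is_derive_RInt (V := R_NormedModule)) with (a := u0); [|exact (ch u Ju)].
  apply (filter_imp J); [|exact (oJ u Ju)].
  intros v Jv; apply (RInt_correct (V := R_CompleteNormedModule)).
  apply (ex_RInt_continuous (V := R_CompleteNormedModule)).
  intros z Hz; apply ch; unfold Rmin, Rmax in Hz; destruct (Rle_dec u0 v);
    [apply (conv u0 z v) | apply (conv v z u0)]; auto. }
apply (is_derive_eq _ _ _ _
  (is_derive_plus _ _ _ _ _ (is_derive_const (V := R_NormedModule) c0 u) D)).
apply (plus_zero_l (G := R_AbelianGroup)).
Qed.

Theorem theorem22 (I J : R -> Prop) (gamma mate : R -> vec)
    (sstar sinv : R -> R) (eps : R) :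
  let kappa := curvature gamma in
  let tau := torsion gamma in
  let f := fun s => tau s / kappa s in
  let g := fun s => Derive tau s / Derive kappa s in
  let sigma := fun s =>
    sqrt ((Derive kappa s) ^ 2 * (g s - f s) ^ 2
          + kappa s ^ 4 * (1 + f s ^ 2) ^ 3) in
  forall (hmate : bertrand_mate I gamma J mate sstar sinv eps)
    (hnh : non_helical I gamma) (hnp : non_planar I gamma)
    (hnh' : non_helical J mate) (hnp' : non_planar J mate)
    (hkappa' : forall s, I s -> Derive kappa s <> 0)
    (hf : forall s, I s -> f s <> 0)
    (hgf : forall s, I s -> g s <> f s)
    (hsstar : forall s, I s ->
       is_derive sstar s (f s * sqrt (1 + g s ^ 2) / (g s - f s)))
    (u0 c0 : R) (hu0 : J u0),
  let sn := fun u => c0 + RInt (fun w =>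
    let s := sinv w in
    kappa s * (g s - f s) * sqrt (1 + f s ^ 2) / (f s * sqrt (1 + g s ^ 2)))
    u0 u in
  exists (K : R -> Prop) (sninv : R -> R),
    correspondence J K sn sninv /\
    let gamman := fun t => normal mate (sninv t) in
    frenet_curve K gamman /\
    forall s, I s ->
      let t := sn (sstar s) in
      let T := tangent gamma s in
      let N := normal gamma s in
      let B := binormal gamma s in
      let k := kappa s in
      let k' := Derive kappa s in
      let k'' := Derive_n kappa 2 s in
      let Tn := tangent gamman in
      let Nn := normal gamman in
      let Bn := binormal gamman in
      let kn := curvature gamman t in
      let tn := torsion gamman t in
      gamman t = (eps *: N)%vec /\
      Tn t = ((- eps / sqrt (1 + f s ^ 2)) *: (T - f s *: B))%vec /\
      Nn t = ((eps / (sigma s * sqrt (1 + f s ^ 2))) *: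
               ((f s * k' * (g s - f s)) *: T
                - (k ^ 2 * (1 + f s ^ 2) ^ 2) *: N
                + (k' * (g s - f s)) *: B))%vec /\
      Bn t = ((1 / sigma s) *:
               ((f s * k ^ 2 * (1 + f s ^ 2)) *: T
                + (k' * (g s - f s)) *: N
                + (k ^ 2 * (1 + f s ^ 2)) *: B))%vec /\
      is_derive Tn t (kn *: Nn t)%vec /\
      is_derive Nn t ((- kn) *: Tn t + tn *: Bn t)%vec /\
      is_derive Bn t ((- tn) *: Nn t)%vec /\
      kn = sigma s / (k ^ 2 * Rpower (1 + f s ^ 2) (3 / 2)) /\
      tn = - eps * (g s - f s) / sigma s ^ 2 *
           (3 * f s * k' ^ 2 * (g s - f s)
            + (3 * k' ^ 2 - k * k'') * (1 + f s ^ 2)).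
Proof.
intros kappa tau f g sigma hmate hnh hnp hnh' hnp' hkappa' hf hgf hsstar u0 c0 hu0 sn.
assert (hb := hmate); destruct hb as [hc [hd [hcorr [he [hN _]]]]].
assert (hI : Defs.open_interval I) by apply hc.
assert (hJ : Defs.open_interval J) by apply hd.
assert (oI : open I) by apply hI.
assert (oJ : open J) by apply hJ.
assert (ee : eps * eps = 1) by (destruct he as [-> | ->]; ring).
assert (kp : forall s, I s -> 0 < kappa s) by (intros s Is; apply hc, Is).
assert (sq : forall x, 0 < sqrt (1 + x ^ 2)) by (intros x; apply sqrt_lt_R0; nra).
destruct (bertrand_torsion_affine I J gamma mate sstar sinv _ eps hmate hsstar)
  as [G hG]; auto.
{ intros s Is; apply Rmult_integral_contrapositive_currified.
  - apply Rmult_integral_contrapositive_currified; [exact (hf s Is)|].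
    apply Rgt_not_eq, sq.
  - apply Rinv_neq_0_compat; assert (N := hgf s Is); lra. }
assert (gG : forall s, I s -> g s = G).
{ intros s Is; unfold g, tau; rewrite (hG s Is); fold kappa; field; exact (hkappa' s Is). }
assert (fG : forall s, I s -> G - f s <> 0).
{ intros s Is Z; apply (hgf s Is); rewrite gG by exact Is; lra. }
(* [D] is ds*/ds and [H] is ds_n/ds* as functions of s. With the number [G] in place of the function
   [g], both are visibly smooth on [I]. *)
set (D := fun s => f s * sqrt (1 + G ^ 2) * / (G - f s)).
set (H := fun s => kappa s * (G - f s) * sqrt (1 + f s ^ 2) * / (f s * sqrt (1 + G ^ 2))).
assert (fS : smooth_on I f) by exact (ratio_smooth I gamma hc).
assert (gfS : smooth_on I (fun s => G - f s)).
{ intros n; apply C_on_plus; [apply C_on_const | apply C_on_opp, fS]. }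
assert (DS : smooth_on I D).
{ intros n; apply C_on_mult; [apply C_on_mult; [apply fS | apply C_on_const]|].
  apply C_on_inv; [exact fG | apply gfS]. }
assert (HS : smooth_on I H).
{ intros n; apply C_on_mult.
  - apply C_on_mult; [|exact (relspeed_smooth I gamma hc n)].
    apply C_on_mult; [apply curvature_smooth, hc | apply gfS].
  - apply C_on_inv; [|apply C_on_mult; [apply fS | apply C_on_const]].
    intros s Is; apply Rmult_integral_contrapositive_currified; [exact (hf s Is)|].
    apply Rgt_not_eq, sq. }
assert (dD : forall s, I s -> is_derive sstar s (D s)).
{ intros s Is; apply (is_derive_eq _ _ _ _ (hsstar s Is)).
  rewrite gG by exact Is; reflexivity. }
destruct (nonvanishing_sign I D hI) as [e0 he0].
{ intros s Is; exact (is_derive_continuity_pt _ _ _ (smooth_on_is_derive I D s DS Is)). }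
{ intros s Is; apply Rmult_integral_contrapositive_currified.
  - apply Rmult_integral_contrapositive_currified; [exact (hf s Is)|].
    apply Rgt_not_eq, sq.
  - apply Rinv_neq_0_compat, fG, Is. }
set (h := fun w => let s := sinv w in
    kappa s * (g s - f s) * sqrt (1 + f s ^ 2) / (f s * sqrt (1 + g s ^ 2))) in sn.
assert (hH : forall u, J u -> h u = H (sinv u)).
{ intros u Ju; unfold h, H; cbv zeta; rewrite gG by apply hcorr, Ju; reflexivity. }
(* Continuity of the integrand rests on that of [sinv], which comes from the derivative of the
   inverse of s*. *)
assert (ch : forall u, J u -> continuous h u).
{ intros u Ju; apply (continuous_ext_loc _ (fun v => H (sinv v))).
  - apply (filter_imp J); [|exact (oJ u Ju)]; intros v Jv; symmetry; apply hH, Jv.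
  - apply (continuous_comp sinv H).
    + apply (ex_derive_continuous (V := R_NormedModule)); exists (/ D (sinv u)).
      exact (is_derive_inverse I sstar D e0 hI dD he0 J sinv oJ hcorr u Ju).
    + apply (smooth_on_continuous I); [exact HS | apply hcorr, Ju]. }
set (Phi := fun s => sn (sstar s)).
(* Fundamental theorem of calculus and chain rule; the product of [D] and [H] collapses to the speed
   of N. *)
assert (dPhi : forall s, I s -> is_derive Phi s (kappa s * sqrt (1 + f s ^ 2))).
{ intros s Is; destruct (proj1 hcorr s Is) as [Js Es].
  apply (is_derive_eq _ _ _ _ (is_derive_Rcomp sn sstar s _ _
    (is_derive_RInt_open_interval J h u0 (sstar s) c0 hJ ch hu0 Js) (dD s Is))).
  rewrite hH, Es by exact Js; unfold D, H.
  assert (n1 := fG s Is); assert (n2 := hf s Is); assert (n3 := sq G).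
  field; repeat split; lra. }
assert (Phip : forall s, I s -> 0 < 1 * (kappa s * sqrt (1 + f s ^ 2))).
{ intros s Is; rewrite Rmult_1_l; apply Rmult_lt_0_compat; auto. }
set (K := fun t => exists s, I s /\ Phi s = t).
assert (hK : Defs.open_interval K) by exact (open_interval_image I Phi _ 1 hI dPhi Phip).
destruct (image_correspondence I Phi) as [p hp].
{ intros a b Ia Ib E.
  destruct (Rtotal_order a b) as [l|[l|l]]; [|exact l|];
    apply (open_interval_increasing I Phi _ 1 hI dPhi Phip) in l; auto; lra. }
fold K in hp.
assert (dp := is_derive_inverse I Phi _ 1 hI dPhi Phip K p (proj1 (proj2 hK)) hp).
(* On [J], [sn] is [Phi] after [sinv]; hence its image is that of [Phi], and its inverse is [sstar]
   after the inverse [p] of [Phi]. *)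
exists K, (fun t => sstar (p t)); split; [split|].
- intros u Ju; destruct (proj2 hcorr u Ju) as [Is Es].
  destruct (proj1 hp _ Is) as [Kt Et].
  unfold Phi in Kt, Et; rewrite Es in Kt, Et.
  split; [exact Kt | rewrite Et; exact Es].
- intros t Kt; destruct (proj2 hp t Kt) as [Is Es].
  split; [apply hcorr, Is | exact Es].
- intros gamman.
  assert (hpI : forall t, K t -> I (p t)) by (intros t Kt; apply hp, Kt).
  assert (hn : forall t, K t -> gamman t = (eps *: normal gamma (p t))%vec).
  { intros t Kt; unfold gamman; rewrite (hN _ (hpI t Kt)), scal_scal, ee, scal_1.
    reflexivity. }
  split; [exact (indicatrix_frenet_curve I gamma G eps hc hG ee K p gamman hK hpI dp hn)|].
  intros s Is t; destruct (proj1 hp s Is) as [Kt Et].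
  assert (A := indicatrix_frenet_apparatus I gamma G eps hc hG ee K p gamman hK hpI dp hn t Kt).
  cbv zeta in A; change (Phi s) with t in Et; rewrite Et, <- (gG s Is) in A.
  exact A.
Qed.
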